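(* Let $\theta=\theta(x)$ be a non-constant real solution, depending only on $x$, of the sine-Gordon equation $\Delta\theta=-2\sin(2\theta)$, and let $w=w(x,y)$ be an associated solution to the Bäcklund transformation, i.e. $(w,\theta)$ is of class $(BT)$ on an open simply connected set containing the origin. Set $a=2\cos\theta(0)+\theta'(0)$, $b=2\cos\theta(0)-\theta'(0)$, assume $ab\neq0$, fix a (real or complex) square root $\sqrt{ab}$ and put $\sqrt{a/b}:=\sqrt{ab}/b$. Let $k\in\mathbb{C}$ be such that $\tanh\frac{w(0,0)}{2}=-\sqrt{\frac ab}\,\tan(k)$. Let $R_0=R(0,0)\in\mathbb{R}$, $S_0=S(0,0)\in\mathbb{R}\setminus\{0\}$, and define \begin{align*} R(x,y)&=R_0+S_0\cosh^2\frac{w(0,0)}{2}\;J\!\left(\frac{2\cos\theta(x)-\theta'(x)}{b}\right)-2S_0\,\frac{\sin\theta(x)\bigl(\cos(\sqrt{ab}\,y+2k)-\cos(2k)\bigr)}{2\cos\theta(0)\cos(2k)-\theta'(0)},\\ S(x,y)&=S_0\,\frac{2\cos\theta(x)\cos(\sqrt{ab}\,y+2k)-\theta'(x)}{2\cos\theta(0)\cos(2k)-\theta'(0)}, \end{align*} where $$J(t)=\int_1^t\frac{u^2+\tanh^2\frac{w(0,0)}{2}}{u^2}\;\frac{bu^2+a}{\sqrt{2(8-ab)u^2-a^2-b^2u^4}}\,du .$$ Here $J\bigl((2\cos\theta(x)-\theta'(x))/b\bigr)$ is understood as the integral along the path $u=u(t)=(2\cos\theta(t)-\theta'(t))/b$,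 $t$ running from $0$ to $x$ (so $u(0)=1$), with the square root in the integrand at $u(t)$ taken to be $4u(t)\sin\theta(t)$. Let $\Omega$ be an open simply connected subset of the domain of $(w,\theta)$, containing the origin, on which these expressions make sense. Then $R+iS$ is, on $\Omega$, the harmonic map to the hyperbolic plane that corresponds to $w$.
   Context: Points of $\mathbb{C}$ are written $z=x+iy$ and identified with $(x,y)$; $\partial_z=\frac12(\partial_x-i\partial_y)$, $\partial_{\bar z}=\frac12(\partial_x+i\partial_y)$, $\Delta=\partial_{xx}^2+\partial_{yy}^2$. Class $(BT)$: a pair of real-valued $C^2$ functions $(w,\theta)$ on an open set is in the class $(BT)$ if it satisfies the Bäcklund transformation $$\partial_x w-\partial_y\theta=-2\sinh w\,\sin\theta,\qquad \partial_y w+\partial_x\theta=-2\cosh w\,\cos\theta .$$ Consequently $w$ solves the sinh-Gordon equation $\Delta w=2\sinh(2w)$ and $\theta$ solves the sine-Gordon equation. When $\theta=\theta(x)$, the function $w$ may still depend on both $x$ and $y$. Target: the hyperbolic plane is the half-plane with coordinates $R+iS$ and metric $(dR^2+dS^2)/S^2$ of curvature $-1$ (the upper half-plane when $S>0$; for $S<0$ the lower half-plane with the same formula for the metric). Harmonic map corresponding to $w$: for a solution $w$ of $\Delta w=2\sinh(2w)$ on an open simply connected set $\Omega\ni 0$, a $C^2$ map $u=R+iS$ on $\Omega$ with $S$ nowhere zero is called the harmonic map (to the hyperbolic plane) that corresponds to $w$ if it satisfies the Beltrami equation $\partial_{\bar z}u/\partial_z u=e^{-2w}$ and it is harmonic for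 the metric $(dR^2+dS^2)/S^2$, i.e. $\partial^2_{z\bar z}u+\frac{i}{S}\,\partial_z u\,\partial_{\bar z}u=0$, with the domain coordinate normalized so that $\dfrac{\partial_z u\,\partial_z\bar u}{S^2}=1$. (Uniqueness is not part of the assertion.) *)

(* Defs.v *)
(* Stdlib reals with Coquelicot.  A real function of (x, y) is curried,
   [R -> R -> R]; planar regions are predicates on [C], whose elements are the
   pairs (x, y) standing for x + i y. *)
From Stdlib Require Export Reals.
From Coquelicot Require Export Coquelicot.

Open Scope R_scope.

Definition Cexp (z : C) : C := (exp (Re z) * cos (Im z), exp (Re z) * sin (Im z)).
Definition Ccos (z : C) : C := ((Cexp (Ci * z) + Cexp (- (Ci * z))) / 2)%C.
Definition Csin (z : C) : C := ((Cexp (Ci * z) - Cexp (- (Ci * z))) / (2 * Ci))%C.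
Definition Ctan (z : C) : C := (Csin z / Ccos z)%C.

Definition unit_interval (t : R) : Prop := 0 <= t <= 1.
Definition unit_square (p : R * R) : Prop :=
  unit_interval (fst p) /\ unit_interval (snd p).

Definition path_in (U : C -> Prop) (g : R -> C) : Prop :=
  continuous_on unit_interval g /\ forall t, unit_interval t -> U (g t).

Definition path_connected (U : C -> Prop) : Prop :=
  forall p q, U p -> U q -> exists g, path_in U g /\ g 0 = p /\ g 1 = q.

(* The second argument of [H] is the parameter along the loop; [H] is a
   homotopy of based loops from [g] to the constant loop. *)
Definition null_homotopic_in (U : C -> Prop) (g : R -> C) : Prop :=
  exists H : R * R -> C,
    continuous_on unit_square H /\
    (forall p, unit_square p -> U (H p)) /\
    (forall t, unit_interval t -> H (0, t) = g t) /\
    (forall t, unit_interval t -> H (1, t) = g 0) /\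
    (forall s, unit_interval s -> H (s, 0) = g 0 /\ H (s, 1) = g 0).

Definition simply_connected (U : C -> Prop) : Prop :=
  path_connected U /\
  forall g, path_in U g -> g 0 = g 1 -> null_homotopic_in U g.

Definition dx (f : R -> R -> R) (x y : R) : R := Derive (fun t => f t y) x.
Definition dy (f : R -> R -> R) (x y : R) : R := Derive (fun t => f x t) y.

Definition laplacian (f : R -> R -> R) (x y : R) : R :=
  dx (dx f) x y + dy (dy f) x y.

(* [ex_diff_n f 2] asks for existence and continuity of [f] and of all its
   partial derivatives up to order 2. *)
Definition C2_on (U : C -> Prop) (f : R -> R -> R) : Prop :=
  forall x y, U (x, y) -> ex_diff_n f 2 x y.

Definition class_BT (U : C -> Prop) (w theta : R -> R -> R) : Prop :=
  C2_on U w /\ C2_on U theta /\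
  forall x y, U (x, y) ->
    dx w x y - dy theta x y = - 2 * sinh (w x y) * sin (theta x y) /\
    dy w x y + dx theta x y = - 2 * cosh (w x y) * cos (theta x y).

Definition sine_Gordon (U : C -> Prop) (theta : R -> R -> R) : Prop :=
  forall x y, U (x, y) -> laplacian theta x y = - 2 * sin (2 * theta x y).

Definition sinh_Gordon (U : C -> Prop) (w : R -> R -> R) : Prop :=
  forall x y, U (x, y) -> laplacian w x y = 2 * sinh (2 * w x y).

Definition Cdx (f : R -> R -> C) (x y : R) : C :=
  (dx (fun s t => Re (f s t)) x y, dx (fun s t => Im (f s t)) x y).
Definition Cdy (f : R -> R -> C) (x y : R) : C :=
  (dy (fun s t => Re (f s t)) x y, dy (fun s t => Im (f s t)) x y).

Definition dz (f : R -> R -> C) (x y : R) : C :=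
  (/ 2 * (Cdx f x y - Ci * Cdy f x y))%C.
Definition dzbar (f : R -> R -> C) (x y : R) : C :=
  (/ 2 * (Cdx f x y + Ci * Cdy f x y))%C.

(* The target carries the metric (dR^2 + dS^2) / S^2 on S > 0 or on S < 0. *)
Definition corresponding_harmonic_map (U : C -> Prop) (w : R -> R -> R)
    (u : R -> R -> C) : Prop :=
  C2_on U w /\ sinh_Gordon U w /\
  C2_on U (fun x y => Re (u x y)) /\ C2_on U (fun x y => Im (u x y)) /\
  forall x y, U (x, y) ->
    let S := Im (u x y) in
    S <> 0 /\
    dz u x y <> RtoC 0 /\
    (dzbar u x y / dz u x y)%C = RtoC (exp (- 2 * w x y)) /\
    (dz (dzbar u) x y + Ci / S * dz u x y * dzbar u x y)%C = RtoC 0 /\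
    (dz u x y * dz (fun s t => Cconj (u s t)) x y / (RtoC S * RtoC S))%C = RtoC 1.

Definition coef_a (theta : R -> R) : R := 2 * cos (theta 0) + Derive theta 0.
Definition coef_b (theta : R -> R) : R := 2 * cos (theta 0) - Derive theta 0.

Definition upath (theta : R -> R) (t : R) : R :=
  (2 * cos (theta t) - Derive theta t) / coef_b theta.

(* [q] stands for the square root of 2 (8 - a b) u^2 - a^2 - b^2 u^4. *)
Definition J_form (a b T u q : R) : R :=
  (u ^ 2 + T ^ 2) / u ^ 2 * ((b * u ^ 2 + a) / q).

(* Pullback of [J_form] du along [upath theta], with the branch
   q = 4 u sin theta of the square root.  Where sin theta = 0 the quotient is
   0/0; for a non-constant solution these points are isolated, so the value
   chosen there does not affect the integral. *)
Definition J_integrand (theta : R -> R) (T t : R) : R :=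
  J_form (coef_a theta) (coef_b theta) T (upath theta t)
    (4 * upath theta t * sin (theta t)) * Derive (upath theta) t.

Definition J_along (theta : R -> R) (T x : R) : R :=
  RInt (J_integrand theta T) 0 x.

Definition denominator (theta : R -> R) (k : C) : C :=
  (RtoC (2 * cos (theta 0)) * Ccos (2 * k) - RtoC (Derive theta 0))%C.

(* In the next two formulas [r] is the chosen square root of a b and [w0] is
   w(0,0).  They are complex-valued because [r] and [k] may be non-real. *)
Definition R_formula (theta : R -> R) (w0 : R) (r k : C) (R0 S0 x y : R) : C :=
  (RtoC (R0 + S0 * cosh (w0 / 2) ^ 2 * J_along theta (tanh (w0 / 2)) x)
   - RtoC (2 * S0)
     * (RtoC (sin (theta x)) * (Ccos (r * y + 2 * k) - Ccos (2 * k))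
        / denominator theta k))%C.

Definition S_formula (theta : R -> R) (r k : C) (S0 x y : R) : C :=
  (RtoC S0
   * ((RtoC (2 * cos (theta x)) * Ccos (r * y + 2 * k) - RtoC (Derive theta x))
      / denominator theta k))%C.

Definition formulas_defined (U : C -> Prop) (theta : R -> R) (w0 : R) (k : C) : Prop :=
  denominator theta k <> RtoC 0 /\
  forall x y, U (x, y) -> ex_RInt (J_integrand theta (tanh (w0 / 2))) 0 x.

(* Main.v *)
Require Import Defs.
From Stdlib Require Import Lra Psatz Classical.

(** The Baecklund system separates once theta depends on x only.  Put
    u(x) = (2 cos theta - theta') / b.  The sine-Gordon equation turns into
    u' = 2 u sin theta, and (2 cos theta + theta')' =
    - 2 sin theta (2 cos theta + theta'), so u has no zero and the product of
    the two quantities is the constant ab.  Hence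
      2 cos theta - theta' = b u,   2 cos theta + theta' = a / u
    ([upath_equations]), and the elliptic integrand of J, taken along u, is
    2 (u + T0^2 / u) cos theta with T0 = tanh (w(0,0) / 2)
    ([is_derive_J_along]).

    In the y direction the only functions needed are the real solutions of
      A' = b G / 2,   G' = - a A / 2,   A(0) = 1,   G(0) = T0,
    which are cos (r y / 2 + k) / cos k and - (r / b) sin (r y / 2 + k) / cos k.
    They are real although r and k need not be, a A^2 + b G^2 is constant, and
      cos (r y + 2 k) = (a A^2 - b G^2) / (a + b T0^2)
    ([amplitude_pair]).

    For w, the product v = u tanh (w / 2) satisfies the Riccati system
    v_x = 0, v_y = - (a + b v^2) / 2, which is linearised by v = G / A.  As the
    slices of the domain may be disconnected, the identity v A = G and the
    absence of zeros of A are obtained by propagating the zero set of a solution of a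
    linear first-order system along paths ([zero_set_propagates],
    [half_tanh_w]).

    With K = S0 cosh^2 (w(0,0) / 2) the two formulas become
      R = R0 + K J - (4 K / b) sin theta (A^2 - 1),   S = K (u A^2 - G^2 / u),
    and differentiation gives, using tanh (w / 2) = G / (u A),
      d_z (R + i S)    = K e^{i theta} u A^2 (1 + tanh (w / 2))^2,
      d_zbar (R + i S) = K e^{i theta} u A^2 (1 - tanh (w / 2))^2,
      S = K u A^2 (1 - tanh^2 (w / 2)).
    The quotient of the first two is e^{- 2 w}, their Hermitian product is S^2,
    and one more derivative gives the harmonic map equation
    ([harmonic_map_of_profile]). *)

(** * Propagation of zero sets along paths *)

(** The supremum of the times up to which [P] holds along a path must be 1. *)
Lemma locally_constant_propagates (U : C -> Prop) (P : C -> Prop) :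
  path_connected U ->
  (forall p, U p -> locally p (fun q => P p <-> P q)) ->
  forall p q, U p -> U q -> P p -> P q.
Proof.
intros U_conn P_loc p q Up Uq Pp.
destruct (U_conn p q Up Uq) as [g [[g_cont g_in] [g0 g1]]].
set (E := fun t => unit_interval t /\ forall s, 0 <= s <= t -> P (g s)).
assert (E0 : E 0).
{ split; [unfold unit_interval; lra | intros s Hs].
  replace s with 0 by lra. now rewrite g0. }
destruct (completeness E) as [m [m_ub m_least]].
{ exists 1. intros t [Ht _]. apply Ht. }
{ now exists 0. }
assert (m01 : unit_interval m).
{ split; [now apply m_ub | apply m_least; intros t [Ht _]; apply Ht]. }
destruct (g_cont m m01 _ (P_loc (g m) (g_in m m01))) as [d Hd].
assert (near : forall s, unit_interval s -> Rabs (s - m) < d ->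
                         (P (g m) <-> P (g s))).
{ intros s Hs sm. apply Hd; assumption. }
destruct d as [d d_pos]; simpl in near.
assert (Et : exists t, E t /\ m - d < t).
{ apply NNPP. intros none.
  assert (m <= m - d); [|lra].
  apply m_least. intros t Et.
  apply Rnot_lt_le. intros lt. apply none. now exists t. }
destruct Et as [t [[t01 Pt] mt]].
assert (tm : t <= m) by (apply m_ub; now split).
assert (Pm : P (g m)).
{ apply (near t t01); [apply Rabs_def1; lra | apply Pt; destruct t01; lra]. }
set (t' := Rmin (m + d / 2) 1).
assert (t'1 : t' <= 1) by apply Rmin_r.
assert (t'm : t' <= m + d / 2) by apply Rmin_l.
assert (Et' : forall s, 0 <= s <= t' -> P (g s)).
{ intros s Hs. destruct (Rle_dec s t) as [st | st]; [apply Pt; lra |].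
  apply near; [split; lra | apply Rabs_def1; lra | exact Pm]. }
assert (t' <= m).
{ apply m_ub. split; [split; [|exact t'1] | exact Et'].
  destruct m01; apply Rmin_glb; lra. }
assert (t' = 1).
{ unfold t' in *. revert H. unfold Rmin. destruct Rle_dec; intros; lra. }
rewrite <- g1. apply Et'. lra.
Qed.

(** Multiplied by the integrating factor exp (- int m), [f] becomes constant. *)
Lemma linear_ode_zero_iff (f m : R -> R) (p d : R) :
  (forall t, Rabs (t - p) < d -> is_derive f t (m t * f t) /\ continuous m t) ->
  forall q, Rabs (q - p) < d -> f p = 0 <-> f q = 0.
Proof.
intros ode q qp.
assert (between : forall s t, Rmin p t <= s <= Rmax p t ->
                  Rabs (t - p) < d -> Rabs (s - p) < d).
{ intros s t Hs Ht. apply Rabs_def2 in Ht.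
  revert Hs. unfold Rmin, Rmax. destruct Rle_dec; intros; apply Rabs_def1; lra. }
set (h := fun t => f t * exp (- RInt m p t)).
assert (h' : forall t, Rabs (t - p) < d -> is_derive h t 0).
{ intros t Ht.
  assert (d_int : is_derive (fun t => RInt m p t) t (m t)).
  { apply is_derive_RInt with p; [|now apply ode].
    assert (pos : 0 < d - Rabs (t - p)) by lra.
    exists (mkposreal _ pos). intros t' Ht'.
    apply (RInt_correct m p t'), ex_RInt_continuous. intros z Hz.
    apply ode, between with t'; [exact Hz|].
    change (Rabs (t' - t) < d - Rabs (t - p)) in Ht'.
    replace (t' - p) with ((t' - t) + (t - p)) by ring.
    eapply Rle_lt_trans; [apply Rabs_triang | lra]. }
  destruct (ode t Ht) as [f' _]. unfold h.
  evar_last.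
  { apply (is_derive_mult f (fun t => exp (- RInt m p t)));
      [exact f' | | intros; apply Rmult_comm].
    apply (is_derive_comp exp (fun t => - RInt m p t)).
    - apply is_derive_exp.
    - apply (is_derive_opp (fun t => RInt m p t)); exact d_int. }
  unfold mult, plus, opp, scal; simpl. unfold mult; simpl. ring. }
assert (hpq : h p = h q).
{ destruct (Rtotal_order p q) as [lt | [eq | gt]].
  - apply (eq_is_derive h); [|exact lt]. intros t Ht. apply h'.
    apply between with q; [unfold Rmin, Rmax; destruct Rle_dec; lra | exact qp].
  - now rewrite eq.
  - symmetry. apply (eq_is_derive h); [|exact gt]. intros t Ht. apply h'.
    apply between with q; [unfold Rmin, Rmax; destruct Rle_dec; lra | exact qp]. }
unfold h in hpq.
replace (RInt m p p) with 0 in hpq by (symmetry; apply (RInt_point p m)).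
rewrite Ropp_0, exp_0, Rmult_1_r in hpq.
assert (exp (- RInt m p q) > 0) by apply exp_pos.
split; intros z0; rewrite z0 in *; nra.
Qed.

Lemma open_box (U : C -> Prop) (x y : R) :
  open U -> U (x, y) -> locally_2d (fun s t => U (s, t)) x y.
Proof.
intros U_open Uxy.
destruct (U_open (x, y) Uxy) as [d Hd].
exists d. intros s t Hs Ht. apply Hd. now split.
Qed.

(** On a small box a point is joined to the centre by a horizontal and a
    vertical segment, on each of which [f] solves a linear equation; so the
    zero set is locally all or nothing, and paths carry this to the whole
    domain, whose horizontal and vertical slices may be disconnected. *)
Lemma zero_set_propagates (U : C -> Prop) (f m1 m2 : R -> R -> R) :
  open U -> path_connected U ->
  (forall x y, U (x, y) ->
     is_derive (fun t => f t y) x (m1 x y * f x y) /\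
     is_derive (fun t => f x t) y (m2 x y * f x y) /\
     continuous (fun t => m1 t y) x /\ continuous (fun t => m2 x t) y) ->
  forall x y x' y', U (x, y) -> U (x', y') -> f x y = 0 -> f x' y' = 0.
Proof.
intros U_open U_conn sys x y x' y' Uxy Uxy' f0.
apply (locally_constant_propagates U (fun p => f (fst p) (snd p) = 0) U_conn)
  with (p := (x, y)) (q := (x', y')); try assumption.
clear - U_open sys. intros [x y] Uxy. simpl.
destruct (open_box U x y U_open Uxy) as [d Hd].
exists d. intros [x' y'] [Hx Hy]. simpl in *.
change (Rabs (x' - x) < d) in Hx. change (Rabs (y' - y) < d) in Hy.
assert (dy : Rabs (y - y) < d).
{ rewrite Rminus_diag, Rabs_R0. apply cond_pos. }
transitivity (f x' y = 0).
- apply (linear_ode_zero_iff (fun t => f t y) (fun t => m1 t y) x d); [|exact Hx].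
  intros t Ht. now destruct (sys t y (Hd t y Ht dy)) as [? [_ [? _]]].
- apply (linear_ode_zero_iff (fun t => f x' t) (fun t => m2 x' t) y d); [|exact Hy].
  intros t Ht. now destruct (sys x' t (Hd x' t Hx Ht)) as [_ [? [_ ?]]].
Qed.

(** * Functions of class C^n on an open set *)

Definition Cn_on (U : C -> Prop) (n : nat) (f : R -> R -> R) : Prop :=
  forall x y, U (x, y) -> ex_diff_n f n x y.

Lemma Cn_on_ext (U : C -> Prop) (n : nat) (f g : R -> R -> R) :
  open U -> (forall x y, U (x, y) -> f x y = g x y) -> Cn_on U n f -> Cn_on U n g.
Proof.
intros U_open eq f_n x y Uxy.
apply ex_diff_n_ext_loc with f; [|now apply f_n].
destruct (open_box U x y U_open Uxy) as [d Hd].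
exists d. intros s t Hs Ht. apply eq. now apply Hd.
Qed.

Lemma Cn_on_S (U : C -> Prop) (n : nat) (f f1 f2 : R -> R -> R) :
  open U ->
  (forall x y, U (x, y) -> is_derive (fun t => f t y) x (f1 x y)) ->
  (forall x y, U (x, y) -> is_derive (fun t => f x t) y (f2 x y)) ->
  Cn_on U 0 f -> Cn_on U n f1 -> Cn_on U n f2 -> Cn_on U (S n) f.
Proof.
intros U_open d1 d2 f_0 f1_n f2_n x y Uxy.
split; [now apply f_0 |].
split; [now exists (f1 x y); apply d1 |].
split; [now exists (f2 x y); apply d2 |].
split; revert x y Uxy.
- apply Cn_on_ext with f1; try assumption.
  intros x y Uxy. symmetry. now apply is_derive_unique, d1.
- apply Cn_on_ext with f2; try assumption.
  intros x y Uxy. symmetry. now apply is_derive_unique, d2.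
Qed.

Lemma Cn_on_pred (U : C -> Prop) (n : nat) (f : R -> R -> R) :
  Cn_on U (S n) f -> Cn_on U n f.
Proof.
intros f_n x y Uxy.
apply ex_diff_n_m with (S n); [apply le_S, le_n | now apply f_n].
Qed.

Lemma Cn_on_const (U : C -> Prop) (n : nat) (c : R) : 
  open U -> Cn_on U n (fun _ _ => c).
Proof.
intros U_open. revert c. induction n as [|n IH]; intros c.
- intros x y _. split; [apply continuity_2d_pt_const | exact I].
- apply Cn_on_S with (fun _ _ => 0) (fun _ _ => 0); try apply IH; try assumption.
  + intros. apply (is_derive_const (V := R_NormedModule)).
  + intros. apply (is_derive_const (V := R_NormedModule)).
  + intros x y _. split; [apply continuity_2d_pt_const | exact I].
Qed.

Lemma Cn_on_plus (U : C -> Prop) (n : nat) (f g : R -> R -> R) :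
  open U -> Cn_on U n f -> Cn_on U n g -> Cn_on U n (fun x y => f x y + g x y).
Proof.
intros U_open. revert f g. induction n as [|n IH]; intros f g f_n g_n.
- intros x y Uxy. split; [|exact I].
  apply continuity_2d_pt_plus; [now apply f_n | now apply g_n].
- apply Cn_on_S with (fun x y => dx f x y + dx g x y) (fun x y => dy f x y + dy g x y).
  + assumption.
  + intros x y Uxy. apply @is_derive_plus; apply Derive_correct;
      [apply (f_n x y Uxy) | apply (g_n x y Uxy)].
  + intros x y Uxy. apply @is_derive_plus; apply Derive_correct;
      [apply (f_n x y Uxy) | apply (g_n x y Uxy)].
  + intros x y Uxy. split; [|exact I].
    apply continuity_2d_pt_plus; [now apply f_n | now apply g_n].
  + apply IH; intros x y Uxy; [apply (f_n x y Uxy) | apply (g_n x y Uxy)].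
  + apply IH; intros x y Uxy; [apply (f_n x y Uxy) | apply (g_n x y Uxy)].
Qed.

Lemma Cn_on_mult (U : C -> Prop) (n : nat) (f g : R -> R -> R) :
  open U -> Cn_on U n f -> Cn_on U n g -> Cn_on U n (fun x y => f x y * g x y).
Proof.
intros U_open. revert f g. induction n as [|n IH]; intros f g f_n g_n.
- intros x y Uxy. split; [|exact I].
  apply continuity_2d_pt_mult; [now apply f_n | now apply g_n].
- assert (f_p := Cn_on_pred U n f f_n). assert (g_p := Cn_on_pred U n g g_n).
  apply Cn_on_S with (fun x y => dx f x y * g x y + f x y * dx g x y)
                     (fun x y => dy f x y * g x y + f x y * dy g x y).
  + assumption.
  + intros x y Uxy. apply (is_derive_mult (fun t => f t y) (fun t => g t y));
      [apply Derive_correct, (f_n x y Uxy) | apply Derive_correct, (g_n x y Uxy)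
      | intros; apply Rmult_comm].
  + intros x y Uxy. apply (is_derive_mult (f x) (g x));
      [apply Derive_correct, (f_n x y Uxy) | apply Derive_correct, (g_n x y Uxy)
      | intros; apply Rmult_comm].
  + intros x y Uxy. split; [|exact I].
    apply continuity_2d_pt_mult; [now apply f_n | now apply g_n].
  + apply Cn_on_plus; [assumption | |]; apply IH; try assumption;
      intros x y Uxy; [apply (f_n x y Uxy) | apply (g_n x y Uxy)].
  + apply Cn_on_plus; [assumption | |]; apply IH; try assumption;
      intros x y Uxy; [apply (f_n x y Uxy) | apply (g_n x y Uxy)].
Qed.

Lemma continuity_pt_of_derive (f : R -> R) (x l : R) :
  is_derive f x l -> continuity_pt f x.
Proof.
intros df. apply continuity_pt_filterlim, (ex_derive_continuous f). now exists l.
Qed.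

Lemma continuous_on_fst (U : C -> Prop) (f f' : R -> R) :
  (forall x y, U (x, y) -> is_derive f x (f' x)) -> Cn_on U 0 (fun x _ => f x).
Proof.
intros df x y Uxy. split; [|exact I].
apply (continuity_1d_2d_pt_comp f (fun x _ => x)); [|apply continuity_2d_pt_id1].
eapply continuity_pt_of_derive, df, Uxy.
Qed.

Lemma continuous_on_snd (U : C -> Prop) (f f' : R -> R) :
  (forall x y, U (x, y) -> is_derive f y (f' y)) -> Cn_on U 0 (fun _ y => f y).
Proof.
intros df x y Uxy. split; [|exact I].
apply (continuity_1d_2d_pt_comp f (fun _ y => y)); [|apply continuity_2d_pt_id2].
eapply continuity_pt_of_derive, df, Uxy.
Qed.

Lemma Cn_on_fst (U : C -> Prop) (n : nat) (f f' : R -> R) :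
  open U -> (forall x y, U (x, y) -> is_derive f x (f' x)) ->
  Cn_on U n (fun x _ => f' x) -> Cn_on U (S n) (fun x _ => f x).
Proof.
intros U_open df f'_n.
apply Cn_on_S with (fun x _ => f' x) (fun _ _ => 0); try assumption.
- intros. apply (is_derive_const (V := R_NormedModule)).
- now apply continuous_on_fst with f'.
- now apply Cn_on_const.
Qed.

Lemma Cn_on_snd (U : C -> Prop) (n : nat) (f f' : R -> R) :
  open U -> (forall x y, U (x, y) -> is_derive f y (f' y)) ->
  Cn_on U n (fun _ y => f' y) -> Cn_on U (S n) (fun _ y => f y).
Proof.
intros U_open df f'_n.
apply Cn_on_S with (fun _ _ => 0) (fun _ y => f' y); try assumption.
- intros. apply (is_derive_const (V := R_NormedModule)).
- now apply continuous_on_snd with f'.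
- now apply Cn_on_const.
Qed.

(** * Complex trigonometric functions *)

Lemma Ccos_components (z : C) :
  Ccos z = (cos (Re z) * cosh (Im z), - (sin (Re z) * sinh (Im z))).
Proof.
destruct z as [x y]. unfold Ccos, Cexp, cosh, sinh.
apply injective_projections; simpl;
  replace (0 * x - 1 * y) with (- y) by ring;
  replace (0 * y + 1 * x) with x by ring;
  rewrite ?Ropp_involutive, cos_neg, sin_neg; field.
Qed.

Lemma Csin_components (z : C) :
  Csin z = (sin (Re z) * cosh (Im z), cos (Re z) * sinh (Im z)).
Proof.
destruct z as [x y]. unfold Csin, Cexp, cosh, sinh.
apply injective_projections; simpl;
  replace (0 * x - 1 * y) with (- y) by ring;
  replace (0 * y + 1 * x) with x by ring;
  rewrite ?Ropp_involutive, cos_neg, sin_neg; field.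
Qed.

Lemma cosh_plus (x y : R) : cosh (x + y) = cosh x * cosh y + sinh x * sinh y.
Proof. unfold cosh, sinh. rewrite Ropp_plus_distr, !exp_plus. field. Qed.

Lemma sinh_plus (x y : R) : sinh (x + y) = sinh x * cosh y + cosh x * sinh y.
Proof. unfold cosh, sinh. rewrite Ropp_plus_distr, !exp_plus. field. Qed.

Lemma Ccos_plus (z z' : C) :
  Ccos (z + z') = (Ccos z * Ccos z' - Csin z * Csin z')%C.
Proof.
rewrite !Ccos_components, !Csin_components. destruct z, z'. simpl.
rewrite cos_plus, sin_plus, cosh_plus, sinh_plus.
apply injective_projections; simpl; ring.
Qed.

Lemma Csin_plus (z z' : C) :
  Csin (z + z') = (Csin z * Ccos z' + Ccos z * Csin z')%C.
Proof.
rewrite !Ccos_components, !Csin_components. destruct z, z'. simpl.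
rewrite cos_plus, sin_plus, cosh_plus, sinh_plus.
apply injective_projections; simpl; ring.
Qed.

Lemma Ccos2_plus_Csin2 (z : C) : (Ccos z * Ccos z + Csin z * Csin z)%C = RtoC 1.
Proof.
rewrite Ccos_components, Csin_components. destruct z as [x y]. simpl.
assert (c := sin2_cos2 x). unfold Rsqr in c.
assert (h : cosh y * cosh y - sinh y * sinh y = 1).
{ unfold cosh, sinh. assert (e : exp y * exp (- y) = 1).
  { rewrite <- exp_plus, Rplus_opp_r. apply exp_0. }
  nra. }
apply injective_projections; simpl; [|ring].
transitivity ((sin x * sin x + cos x * cos x) * (cosh y * cosh y - sinh y * sinh y));
  [ring | rewrite c, h; ring].
Qed.

Lemma Cmult_eq_reg_l (c z z' : C) : c <> RtoC 0 -> (c * z)%C = (c * z')%C -> z = z'.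
Proof.
intros c0 e.
transitivity (/ c * (c * z))%C; [field; exact c0 | rewrite e; field; exact c0].
Qed.

(** [cos (r t)] and [sin (r t) / r] are even functions of [r], hence real as
    soon as [r^2] is; [r] itself is real or purely imaginary, and the pair is
    then trigonometric or hyperbolic. *)
Lemma trig_of_real_square_root (r : C) (m : R) :
  m <> 0 -> (r * r)%C = RtoC m ->
  exists c s : R -> R,
    (forall t, Ccos (r * RtoC t) = RtoC (c t)) /\
    (forall t, Csin (r * RtoC t) = (r * RtoC (s t))%C) /\
    (forall t, is_derive c t (- m * s t)) /\
    (forall t, is_derive s t (c t)) /\ c 0 = 1 /\ s 0 = 0.
Proof.
intros m0 rm. destruct r as [p q].
assert (e1 := f_equal fst rm). assert (e2 := f_equal snd rm). simpl in e1, e2.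
assert (H : q = 0 /\ p <> 0 \/ p = 0 /\ q <> 0)
  by (destruct (Req_dec p 0); [right | left]; nra).
destruct H as [[-> p0] | [-> q0]].
- exists (fun t => cos (p * t)), (fun t => sin (p * t) / p).
  split; [|split; [|split; [|split; [|split]]]]; try intros t.
  + rewrite Ccos_components. simpl.
    replace (p * 0 + 0 * t) with 0 by ring.
    replace (p * t - 0 * 0) with (p * t) by ring.
    rewrite sinh_0, cosh_0.
    apply injective_projections; simpl; ring.
  + rewrite Csin_components. simpl.
    replace (p * 0 + 0 * t) with 0 by ring.
    replace (p * t - 0 * 0) with (p * t) by ring.
    rewrite sinh_0, cosh_0. apply injective_projections; simpl; field; assumption.
  + auto_derive; [trivial|]. rewrite <- e1. field; assumption.
  + auto_derive; [trivial|]. field; assumption.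
  + rewrite Rmult_0_r. apply cos_0.
  + rewrite Rmult_0_r, sin_0. field; assumption.
- exists (fun t => cosh (q * t)), (fun t => sinh (q * t) / q).
  split; [|split; [|split; [|split; [|split]]]]; try intros t.
  + rewrite Ccos_components. simpl.
    replace (0 * t - q * 0) with 0 by ring.
    replace (0 * 0 + q * t) with (q * t) by ring.
    rewrite sin_0, cos_0.
    apply injective_projections; simpl; ring.
  + rewrite Csin_components. simpl.
    replace (0 * t - q * 0) with 0 by ring.
    replace (0 * 0 + q * t) with (q * t) by ring.
    rewrite sin_0, cos_0.
    apply injective_projections; simpl; field; assumption.
  + unfold cosh, sinh. auto_derive; [trivial|]. rewrite <- e1. field; assumption.
  + unfold cosh, sinh. auto_derive; [trivial|]. field; assumption.
  + rewrite Rmult_0_r. apply cosh_0.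
  + rewrite Rmult_0_r, sinh_0. field; assumption.
Qed.

(** [A] and [G] are [cos (r y / 2 + k) / cos k] and
    [- (r / b) sin (r y / 2 + k) / cos k].  By the addition formulas they only
    involve [k] through [tan k], that is through [T0 / r], which makes them
    real.  The last two properties are [cos^2 + sin^2 = 1] and
    [cos^2 - sin^2 = cos (r y + 2 k)], multiplied by [a / cos^2 k]; applied at
    [y = 0], the first gives [(a + b T0^2) cos^2 k = a], so that the constant
    [a + b T0^2] does not vanish. *)
Lemma amplitude_pair (a b T0 : R) (r k : C) :
  a * b <> 0 -> (r * r)%C = RtoC (a * b) -> Ccos k <> RtoC 0 ->
  RtoC T0 = (- (r / RtoC b * Ctan k))%C ->
  exists A G : R -> R,
    (forall y, is_derive A y (b / 2 * G y)) /\
    (forall y, is_derive G y (- (a / 2) * A y)) /\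
    A 0 = 1 /\ G 0 = T0 /\ a + b * T0 ^ 2 <> 0 /\
    (forall y, a * A y ^ 2 + b * G y ^ 2 = a + b * T0 ^ 2) /\
    (forall y, Ccos (r * RtoC y + 2 * k)
               = RtoC ((a * A y ^ 2 - b * G y ^ 2) / (a + b * T0 ^ 2))).
Proof.
intros ab0 rab k0 T0_eq.
assert (a0 : a <> 0) by (intros ->; lra).
assert (b0 : b <> 0) by (intros ->; lra).
assert (Cb0 : RtoC b <> RtoC 0) by (intros e; apply b0, RtoC_inj, e).
destruct (trig_of_real_square_root r (a * b) ab0 rab)
  as [c [s [Hc [Hs [dc [ds [c0 s0]]]]]]].
set (K := Ccos k) in *. set (L := Csin k).
(* The equation for [tan k], freed of denominators: all that is used about [k]. *)
assert (TK : (RtoC b * RtoC T0 * K = - (r * L))%C).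
{ rewrite T0_eq. unfold Ctan. fold K L. field. now split. }
assert (KL : (K * K + L * L)%C = RtoC 1) by apply Ccos2_plus_Csin2.
assert (KK : (RtoC (a + b * T0 ^ 2) * (K * K))%C = RtoC a).
{ rewrite RtoC_plus, RtoC_mult, RtoC_pow.
  assert (e : (RtoC b * (RtoC b * RtoC T0 * RtoC T0 * (K * K))
               = RtoC b * (RtoC a * (L * L)))%C).
  { transitivity ((RtoC b * RtoC T0 * K) * (RtoC b * RtoC T0 * K))%C; [ring|].
    rewrite TK. transitivity ((r * r) * (L * L))%C; [ring|].
    rewrite rab, RtoC_mult. ring. }
  apply (Cmult_eq_reg_l _ _ _ Cb0) in e.
  transitivity (RtoC a * (K * K) + RtoC b * RtoC T0 * RtoC T0 * (K * K))%C;
    [simpl; ring|].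
  rewrite e. transitivity (RtoC a * (K * K + L * L))%C; [ring|]. rewrite KL. ring. }
assert (den0 : a + b * T0 ^ 2 <> 0).
{ intros e. rewrite e, Cmult_0_l in KK. apply a0. now apply RtoC_inj. }
set (A := fun y => c (y / 2) + b * T0 * s (y / 2)).
set (G := fun y => T0 * c (y / 2) - a * s (y / 2)).
assert (cosphi : forall y, Ccos (r * RtoC (y / 2) + k) = (K * RtoC (A y))%C).
{ intros y. rewrite Ccos_plus, Hc, Hs. fold K L. unfold A.
  rewrite RtoC_plus, !RtoC_mult.
  transitivity (RtoC (c (y / 2)%R) * K + RtoC (s (y / 2)%R) * (- (r * L)))%C; [ring|].
  rewrite <- TK. ring. }
assert (sinphi : forall y,
  (r * Csin (r * RtoC (y / 2) + k) = - (RtoC b * K * RtoC (G y)))%C).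
{ intros y. rewrite Csin_plus, Hc, Hs. fold K L. unfold G.
  rewrite RtoC_minus, !RtoC_mult.
  transitivity ((r * r) * RtoC (s (y / 2)%R) * K
                - RtoC (c (y / 2)%R) * (- (r * L)))%C; [ring|].
  rewrite <- TK, rab, RtoC_mult. ring. }
assert (inv : forall y,
  (K * K * RtoC (a * A y ^ 2 + b * G y ^ 2))%C = RtoC a /\
  (K * K * RtoC (a * A y ^ 2 - b * G y ^ 2)
   = RtoC a * Ccos (r * RtoC y + 2 * k))%C).
{ intros y.
  assert (pyth := Ccos2_plus_Csin2 (r * RtoC (y / 2) + k)).
  replace (r * RtoC y + 2 * k)%C with ((r * RtoC (y / 2) + k) + (r * RtoC (y / 2) + k))%C.
  2:{ rewrite RtoC_div by lra. field. }
  rewrite Ccos_plus. specialize (cosphi y). specialize (sinphi y).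
  set (X := Ccos (r * RtoC (y / 2) + k)) in *.
  set (Y := Csin (r * RtoC (y / 2) + k)) in *.
  assert (sq : (RtoC a * (Y * Y) = K * K * (RtoC b * (RtoC (G y) * RtoC (G y))))%C).
  { apply (Cmult_eq_reg_l (RtoC b)); [exact Cb0|].
    transitivity ((RtoC (a * b)) * (Y * Y))%C; [rewrite RtoC_mult; ring|].
    rewrite <- rab. transitivity ((r * Y) * (r * Y))%C; [ring|].
    rewrite sinphi. ring. }
  rewrite RtoC_minus, RtoC_plus, !RtoC_mult, !RtoC_pow. simpl.
  split.
  - transitivity (RtoC a * (X * X + Y * Y))%C; [|rewrite pyth; ring].
    transitivity (RtoC a * (X * X) + RtoC a * (Y * Y))%C; [|ring].
    rewrite sq, cosphi. ring.
  - transitivity (RtoC a * (X * X) - RtoC a * (Y * Y))%C; [|ring].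
    rewrite sq, cosphi. ring. }
assert (KK0 : (K * K)%C <> RtoC 0) by now apply Cmult_neq_0.
exists A, G. split; [|split; [|split; [|split; [|split; [|split]]]]].
- intros y. unfold A. evar_last.
  { apply (is_derive_plus (fun y => c (y / 2)) (fun y => b * T0 * s (y / 2))).
    - apply (is_derive_comp c (fun y => y / 2)); [apply dc |].
      instantiate (1 := / 2). auto_derive; [trivial | field].
    - apply (is_derive_scal (fun y => s (y / 2))).
      apply (is_derive_comp s (fun y => y / 2)); [apply ds |].
      instantiate (1 := / 2). auto_derive; [trivial | field]. }
  unfold plus, scal, G; simpl; unfold mult; simpl. field.
- intros y. unfold G. evar_last.
  { apply (is_derive_minus (fun y => T0 * c (y / 2)) (fun y => a * s (y / 2)));
    apply is_derive_scal.
    - apply (is_derive_comp c (fun y => y / 2)); [apply dc |].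
      instantiate (1 := / 2). auto_derive; [trivial | field].
    - apply (is_derive_comp s (fun y => y / 2)); [apply ds |].
      instantiate (1 := / 2). auto_derive; [trivial | field]. }
  unfold minus, plus, opp, scal, A; simpl; unfold mult; simpl. field.
- unfold A. replace (0 / 2) with 0 by field. rewrite c0, s0. ring.
- unfold G. replace (0 / 2) with 0 by field. rewrite c0, s0. ring.
- exact den0.
- intros y. apply RtoC_inj, (Cmult_eq_reg_l (K * K)%C); [exact KK0|].
  rewrite (proj1 (inv y)), <- KK. ring.
- intros y. apply (Cmult_eq_reg_l (RtoC a)); [intros e; apply a0, RtoC_inj, e|].
  rewrite <- (proj2 (inv y)), RtoC_div, <- KK by exact den0. field.
  intros e; apply den0, RtoC_inj, e.
Qed.

(** * The profile theta and the function u *)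

(** Both [2 cos theta - theta'] and [2 cos theta + theta'] solve linear
    first-order equations with opposite coefficients: the first has no zero
    because [b] is not 0, and their product keeps its value [ab]. *)
Lemma upath_equations (D : C -> Prop) (theta : R -> R) :
  open D -> path_connected D -> D (0, 0) ->
  sine_Gordon D (fun x _ => theta x) -> C2_on D (fun x _ => theta x) ->
  coef_a theta * coef_b theta <> 0 ->
  forall x y, D (x, y) ->
    let u := upath theta x in
    u <> 0 /\
    cos (theta x) = (coef_b theta * u + coef_a theta / u) / 4 /\
    is_derive theta x ((coef_a theta / u - coef_b theta * u) / 2) /\
    is_derive (upath theta) x (2 * sin (theta x) * u).
Proof.
intros D_open D_conn D0 sG th_C2 ab0.
set (a := coef_a theta) in *. set (b := coef_b theta) in *.
assert (a0 : a <> 0) by (intros e; apply ab0; rewrite e; ring).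
assert (b0 : b <> 0) by (intros e; apply ab0; rewrite e; ring).
set (lo := fun x => 2 * cos (theta x) - Derive theta x).
set (hi := fun x => 2 * cos (theta x) + Derive theta x).
assert (d1 : forall x y, D (x, y) -> is_derive theta x (Derive theta x)).
{ intros x y Dxy. apply Derive_correct.
  destruct (th_C2 x y Dxy) as [_ [ex _]]. exact ex. }
assert (d2 : forall x y, D (x, y) ->
             is_derive (Derive theta) x (- 4 * sin (theta x) * cos (theta x))).
{ intros x y Dxy. evar_last.
  - apply Derive_correct.
    destruct (th_C2 x y Dxy) as [_ [_ [_ [[_ [ex _]] _]]]]. exact ex.
  - assert (e := sG x y Dxy). unfold laplacian in e.
    replace (dy (dy (fun x _ => theta x)) x y) with 0 in e.
    2:{ unfold dy. symmetry. etransitivity; [|apply (Derive_const 0 y)].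
        apply Derive_ext. intros t. apply Derive_const. }
    change (Derive (Derive theta) x + 0 = - 2 * sin (2 * theta x)) in e.
    rewrite sin_2a in e. lra. }
assert (dlo : forall x y, D (x, y) -> is_derive lo x (2 * sin (theta x) * lo x)).
{ intros x y Dxy. unfold lo. assert (e1 := d1 x y Dxy). assert (e2 := d2 x y Dxy).
  auto_derive.
  - repeat split; eexists; eassumption.
  - change (Derive (fun x => Derive theta x) x) with (Derive (Derive theta) x).
    rewrite (is_derive_unique _ _ _ e2).
    change (Derive (fun x => theta x) x) with (Derive theta x). ring. }
assert (dhi : forall x y, D (x, y) -> is_derive hi x (- 2 * sin (theta x) * hi x)).
{ intros x y Dxy. unfold hi. assert (e1 := d1 x y Dxy). assert (e2 := d2 x y Dxy).
  auto_derive.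
  - repeat split; eexists; eassumption.
  - change (Derive (fun x => Derive theta x) x) with (Derive (Derive theta) x).
    rewrite (is_derive_unique _ _ _ e2).
    change (Derive (fun x => theta x) x) with (Derive theta x). ring. }
assert (c_sin : forall x y, D (x, y) -> continuous (fun t => 2 * sin (theta t)) x).
{ intros x y Dxy. assert (e1 := d1 x y Dxy).
  apply (ex_derive_continuous (fun t => 2 * sin (theta t))).
  auto_derive. eexists; eassumption. }
assert (lo_neq0 : forall x y, D (x, y) -> lo x <> 0).
{ intros x y Dxy lo0. apply b0. change (lo 0 = 0).
  apply (zero_set_propagates D (fun x _ => lo x) (fun x _ => 2 * sin (theta x))
           (fun _ _ => 0) D_open D_conn) with (x := x) (y := y) (y' := 0);
    try assumption.
  clear x y Dxy lo0. intros x y Dxy. split; [|split; [|split]].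
  - now apply dlo with y.
  - rewrite Rmult_0_l. apply (is_derive_const (V := R_NormedModule)).
  - now apply c_sin with y.
  - apply continuous_const. }
assert (lohi : forall x y, D (x, y) -> lo x * hi x = a * b).
{ intros x y Dxy. apply Rminus_diag_uniq.
  apply (zero_set_propagates D (fun x _ => lo x * hi x - a * b) (fun _ _ => 0)
           (fun _ _ => 0) D_open D_conn) with (x := 0) (y := 0) (y' := y);
    try assumption.
  - clear x y Dxy. intros x y Dxy. split; [|split; [|split]].
    + assert (e1 := dlo x y Dxy). assert (e2 := dhi x y Dxy). auto_derive.
      * split; [eexists; exact e1 | split; [eexists; exact e2 | trivial]].
      * change (fun x => lo x) with lo. change (fun x => hi x) with hi.
        rewrite (is_derive_unique _ _ _ e1), (is_derive_unique _ _ _ e2). ring.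
    + rewrite Rmult_0_l. apply (is_derive_const (V := R_NormedModule)).
    + apply continuous_const.
    + apply continuous_const.
  - unfold lo, hi, a, b, coef_a, coef_b. ring. }
intros x y Dxy u.
assert (lo_u : lo x = b * u) by (unfold u, upath; fold b; fold (lo x); field; exact b0).
assert (u0 : u <> 0).
{ intros e. apply (lo_neq0 x y Dxy). rewrite lo_u, e. ring. }
assert (hi_u : hi x = a / u).
{ apply (Rmult_eq_reg_l (b * u)); [|now apply Rmult_integral_contrapositive_currified].
  rewrite <- lo_u at 1. rewrite (lohi x y Dxy). field. exact u0. }
split; [exact u0 | split; [|split]].
- rewrite <- lo_u, <- hi_u. unfold lo, hi. field.
- rewrite <- lo_u, <- hi_u. evar_last; [exact (d1 x y Dxy) |]. unfold lo, hi. field.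
- evar_last.
  + apply is_derive_ext with (fun t => / b * lo t).
    * intros t. unfold upath. fold b. fold (lo t). apply Rmult_comm.
    * apply is_derive_scal, (dlo x y Dxy).
  + rewrite lo_u.
    change (/ b * (2 * sin (theta x) * (b * u)) = 2 * sin (theta x) * u).
    field. exact b0.
Qed.

Lemma nonzero_derive_isolates (f : R -> R) (x l : R) :
  is_derive f x l -> (f x = 0 -> l <> 0) ->
  exists d : posreal, forall t, t <> x -> Rabs (t - x) < d -> f t <> 0.
Proof.
intros df l0.
destruct (Req_dec (f x) 0) as [f0 | f0].
- apply is_derive_Reals in df.
  destruct (df (Rabs l) (Rabs_pos_lt l (l0 f0))) as [d Hd].
  exists d. intros t tx td ft.
  assert (H := Hd (t - x) ltac:(lra) td).
  replace (x + (t - x)) with t in H by ring. rewrite ft, f0 in H.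
  replace ((0 - 0) / (t - x) - l) with (- l) in H by (field; lra).
  rewrite Rabs_Ropp in H. lra.
- assert (f_cont : continuous f x) by (apply (ex_derive_continuous f); now exists l).
  assert (pos : 0 < Rabs (f x)) by now apply Rabs_pos_lt.
  destruct (f_cont _ (locally_ball (f x) (mkposreal _ pos))) as [d Hd].
  exists d. intros t _ td ft.
  assert (H := Hd t td). change (Rabs (f t - f x) < Rabs (f x)) in H.
  rewrite ft, Rminus_0_l, Rabs_Ropp in H. lra.
Qed.

(** At a common zero of [sin theta] and [theta'] the first integral
    [4 cos^2 theta - theta'^2 = ab] gives [ab = 4], hence
    [theta'^2 = - 4 sin^2 theta] everywhere, and theta is constant. *)
Lemma sin_theta_isolated_zeros (D : C -> Prop) (theta : R -> R) :
  open D -> path_connected D -> D (0, 0) ->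
  sine_Gordon D (fun x _ => theta x) -> C2_on D (fun x _ => theta x) ->
  coef_a theta * coef_b theta <> 0 ->
  (exists p q : C, D p /\ D q /\ theta (fst p) <> theta (fst q)) ->
  forall x y, D (x, y) ->
  exists d : posreal, forall t, t <> x -> Rabs (t - x) < d -> sin (theta t) <> 0.
Proof.
intros D_open D_conn D0 sG th_C2 ab0 nonconst x y Dxy.
assert (eqs := upath_equations D theta D_open D_conn D0 sG th_C2 ab0).
set (a := coef_a theta) in *. set (b := coef_b theta) in *.
destruct (eqs x y Dxy) as [u0 [cos_u [dth _]]].
apply (nonzero_derive_isolates (fun t => sin (theta t)) x
         (((a / upath theta x - b * upath theta x) / 2) * cos (theta x))).
{ apply (is_derive_comp sin theta); [apply is_derive_sin | exact dth]. }
intros sin0.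
assert (cos2 : cos (theta x) * cos (theta x) = 1).
{ assert (e := sin2_cos2 (theta x)). unfold Rsqr in e. rewrite sin0 in e. lra. }
apply Rmult_integral_contrapositive_currified; [|intros c0; rewrite c0 in cos2; lra].
intros th'0.
assert (ab4 : a * b = 4).
{ assert (e : a / upath theta x = b * upath theta x) by lra.
  rewrite e in cos_u. rewrite cos_u in cos2.
  replace (a * b) with (a / upath theta x * (b * upath theta x)) by (field; exact u0).
  rewrite e. lra. }
assert (flat : forall s t, D (s, t) -> is_derive theta s 0).
{ intros s t Dst. destruct (eqs s t Dst) as [v0 [cos_v [dv _]]].
  evar_last; [exact dv |].
  assert (e := sin2_cos2 (theta s)). unfold Rsqr in e. rewrite cos_v in e.
  set (v := upath theta s) in *.
  assert (av : a / v * (b * v) = 4) by (rewrite <- ab4; field; exact v0).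
  set (X := a / v) in *. set (Y := b * v) in *.
  assert (0 <= sin (theta s) * sin (theta s)) by apply Rle_0_sqr.
  assert ((X - Y) * (X - Y) <= 0) by nra.
  nra. }
destruct nonconst as [[p1 p2] [[q1 q2] [Dp [Dq ne]]]]. apply ne. simpl.
symmetry. apply Rminus_diag_uniq.
apply (zero_set_propagates D (fun s _ => theta s - theta p1) (fun _ _ => 0)
         (fun _ _ => 0) D_open D_conn) with (x := p1) (y := p2) (y' := q2);
  try assumption; [|ring].
intros s t Dst. split; [|split; [|split]].
- rewrite Rmult_0_l. assert (e := flat s t Dst). auto_derive.
  + eexists; exact e.
  + change (fun x => theta x) with theta. rewrite (is_derive_unique _ _ _ e). ring.
- rewrite Rmult_0_l. apply (is_derive_const (V := R_NormedModule)).
- apply continuous_const.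
- apply continuous_const.
Qed.

(** Integrals over small intervals ending at [x] do not see the value of the
    integrand at [x]; so the fundamental theorem of calculus applies to any
    continuous [g] that agrees with [f] near [x] except at [x]. *)
Lemma is_derive_RInt_punctured (f g : R -> R) (x0 x : R) (d : posreal) :
  ex_RInt f x0 x ->
  (forall t, t <> x -> Rabs (t - x) < d -> f t = g t) ->
  (forall t, Rabs (t - x) < d -> continuous g t) ->
  is_derive (RInt f x0) x (g x).
Proof.
intros f_int fg g_cont.
assert (near : forall z t, Rabs (z - x) < d -> Rmin x z <= t <= Rmax x z ->
                           Rabs (t - x) < d).
{ intros z t Hz. apply Rabs_def2 in Hz. unfold Rmin, Rmax.
  destruct Rle_dec; intros; apply Rabs_def1; lra. }
assert (g_int : forall z, Rabs (z - x) < d -> ex_RInt g x z).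
{ intros z Hz. apply (ex_RInt_continuous g). intros t Ht.
  apply g_cont. now apply near with z. }
assert (fg_int : forall z, Rabs (z - x) < d ->
          forall t, Rmin x z < t < Rmax x z -> f t = g t).
{ intros z Hz t Ht. apply fg; [|apply near with z; [exact Hz | lra]].
  revert Ht. unfold Rmin, Rmax. destruct Rle_dec; intros; lra. }
apply is_derive_ext_loc with (fun z => RInt f x0 x + RInt g x z).
{ exists d. intros z Hz. change (Rabs (z - x) < d) in Hz.
  rewrite <- (RInt_ext f g) by (apply fg_int, Hz).
  apply (RInt_Chasles f x0 x z); [exact f_int |].
  apply ex_RInt_ext with g; [|now apply g_int].
  intros t Ht. symmetry. now apply fg_int with z. }
evar_last.
{ apply (is_derive_plus (fun _ => RInt f x0 x) (fun z => RInt g x z)).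
  - apply is_derive_const.
  - apply is_derive_RInt with x.
    + exists d. intros z Hz. apply (RInt_correct g x z). now apply g_int.
    + apply g_cont. rewrite Rminus_diag, Rabs_R0. apply cond_pos. }
apply Rplus_0_l.
Qed.

(** Away from the zeros of [sin theta], the factor [u' = 2 u sin theta] cancels
    the square root [4 u sin theta] and [b u^2 + a = 4 u cos theta]; what is
    left extends continuously across these isolated zeros. *)
Lemma is_derive_J_along (D : C -> Prop) (theta : R -> R) (T : R) :
  open D -> path_connected D -> D (0, 0) ->
  sine_Gordon D (fun x _ => theta x) -> C2_on D (fun x _ => theta x) ->
  coef_a theta * coef_b theta <> 0 ->
  (exists p q : C, D p /\ D q /\ theta (fst p) <> theta (fst q)) ->
  forall x y, D (x, y) -> ex_RInt (J_integrand theta T) 0 x ->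
  let u := upath theta x in
  is_derive (J_along theta T) x (2 * (u + T ^ 2 / u) * cos (theta x)).
Proof.
intros D_open D_conn D0 sG th_C2 ab0 nonconst x y Dxy J_int.
assert (eqs := upath_equations D theta D_open D_conn D0 sG th_C2 ab0).
destruct (sin_theta_isolated_zeros D theta D_open D_conn D0 sG th_C2 ab0
            nonconst x y Dxy) as [d1 Hd1].
destruct (open_box D x y D_open Dxy) as [d2 Hd2].
assert (Dt : forall t, Rabs (t - x) < Rmin d1 d2 -> D (t, y)).
{ intros t Ht. apply Hd2.
  - eapply Rlt_le_trans; [exact Ht | apply Rmin_r].
  - rewrite Rminus_diag, Rabs_R0. apply cond_pos. }
intros u. unfold J_along, u.
apply (is_derive_RInt_punctured (J_integrand theta T)
  (fun t => 2 * (upath theta t + T ^ 2 / upath theta t) * cos (theta t))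
  0 x (mkposreal _ (Rmin_stable_in_posreal d1 d2))); [exact J_int | |]; simpl.
- intros t tx td. destruct (eqs t y (Dt t td)) as [u0 [cos_u [_ du]]].
  assert (s0 : sin (theta t) <> 0).
  { apply Hd1; [exact tx | eapply Rlt_le_trans; [exact td | apply Rmin_l]]. }
  unfold J_integrand, J_form. rewrite (is_derive_unique _ _ _ du), cos_u.
  field. now split.
- intros t td. destruct (eqs t y (Dt t td)) as [u0 [_ [dth du]]].
  apply (ex_derive_continuous
    (fun t => 2 * (upath theta t + T ^ 2 / upath theta t) * cos (theta t))).
  auto_derive. repeat split; try assumption; eexists; eassumption.
Qed.

(** * The function w *)

Lemma cosh_tanh (z : R) : cosh z ^ 2 * (1 - tanh z ^ 2) = 1.
Proof.
assert (p := exp_pos z). unfold tanh, sinh, cosh. rewrite exp_Ropp.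
field. split; nra.
Qed.

Lemma half_tanh_exp (z : R) : tanh (z / 2) = (exp z - 1) / (exp z + 1).
Proof.
assert (e : exp z = exp (z / 2) * exp (z / 2)).
{ rewrite <- exp_plus. f_equal. field. }
assert (p := exp_pos (z / 2)).
unfold tanh, sinh, cosh. rewrite e, exp_Ropp. field. split; nra.
Qed.

Lemma exp_half_tanh (z : R) :
  1 + tanh (z / 2) <> 0 /\
  exp (-2 * z) * (1 + tanh (z / 2)) ^ 2 = (1 - tanh (z / 2)) ^ 2.
Proof.
rewrite half_tanh_exp. assert (p := exp_pos z).
replace (exp (-2 * z)) with (/ (exp z * exp z)).
2:{ rewrite <- exp_plus, <- exp_Ropp. f_equal. ring. }
split; [|field; lra].
replace (1 + (exp z - 1) / (exp z + 1)) with (2 * exp z / (exp z + 1)) by (field; lra).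
apply Rgt_not_eq, Rdiv_lt_0_compat; lra.
Qed.

Lemma sinh_half_tanh (z : R) :
  (1 - tanh (z / 2) ^ 2) * sinh z = 2 * tanh (z / 2).
Proof.
rewrite half_tanh_exp. unfold sinh. rewrite exp_Ropp.
assert (p := exp_pos z). field. lra.
Qed.

Lemma cosh_half_tanh (z : R) :
  (1 - tanh (z / 2) ^ 2) * cosh z = 1 + tanh (z / 2) ^ 2.
Proof.
rewrite half_tanh_exp. unfold cosh. rewrite exp_Ropp.
assert (p := exp_pos z). field. lra.
Qed.

Lemma is_derive_half_tanh (f : R -> R) (x l : R) :
  is_derive f x l ->
  is_derive (fun t => tanh (f t / 2)) x ((1 - tanh (f x / 2) ^ 2) / 2 * l).
Proof.
intros df.
apply is_derive_ext with (fun t => (exp (f t) - 1) / (exp (f t) + 1)).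
{ intros t. now rewrite half_tanh_exp. }
rewrite half_tanh_exp. assert (p := exp_pos (f x)).
auto_derive.
- repeat split; [eexists; exact df .. | lra].
- change (fun x => f x) with f. rewrite (is_derive_unique _ _ _ df). field. lra.
Qed.

Lemma BT_derivatives (D : C -> Prop) (w : R -> R -> R) (theta : R -> R) (x y th' : R) :
  class_BT D w (fun x _ => theta x) -> D (x, y) -> is_derive theta x th' ->
  is_derive (fun t => w t y) x (- 2 * sinh (w x y) * sin (theta x)) /\
  is_derive (fun t => w x t) y (- 2 * cosh (w x y) * cos (theta x) - th').
Proof.
intros [w_C2 [_ BT]] Dxy dth.
destruct (w_C2 x y Dxy) as [_ [ex1 [ex2 _]]].
destruct (BT x y Dxy) as [e1 e2].
replace (dy (fun x _ => theta x) x y) with 0 in e1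
  by (symmetry; apply (Derive_const (theta x) y)).
replace (dx (fun x _ => theta x) x y) with th' in e2
  by (symmetry; now apply is_derive_unique).
split; (evar_last; [apply Derive_correct; eassumption |]).
- rewrite Rminus_0_r in e1. exact e1.
- rewrite <- e2. change (dy w x y = dy w x y + th' - th'). ring.
Qed.

(** The terms in [theta'] of [w_xx] and [w_yy] cancel. *)
Lemma BT_sinh_Gordon (D : C -> Prop) (w : R -> R -> R) (theta th' : R -> R) :
  open D -> (forall x y, D (x, y) -> is_derive theta x (th' x)) ->
  class_BT D w (fun x _ => theta x) -> sinh_Gordon D w.
Proof.
intros D_open dth BT x y Dxy.
assert (d := fun x y Dxy => BT_derivatives D w theta x y (th' x) BT Dxy (dth x y Dxy)).
destruct (d x y Dxy) as [d1 d2]. assert (dt := dth x y Dxy).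
unfold laplacian, dx, dy. destruct (open_box D x y D_open Dxy) as [e He].
assert (refl : forall z, Rabs (z - z) < e).
{ intros z. rewrite Rminus_diag, Rabs_R0. apply cond_pos. }
rewrite (Derive_ext_loc _ (fun t : R => - 2 * sinh (w t y) * sin (theta t))).
2:{ exists e. intros t Ht. apply is_derive_unique, d, He; [exact Ht | apply refl]. }
rewrite (Derive_ext_loc (fun t => Derive _ t)
           (fun t : R => - 2 * cosh (w x t) * cos (theta x) - th' x)).
2:{ exists e. intros t Ht. apply is_derive_unique, d, He; [apply refl | exact Ht]. }
assert (xx : is_derive (fun t : R => - 2 * sinh (w t y) * sin (theta t)) x
  (4 * sinh (w x y) * cosh (w x y) * (sin (theta x) * sin (theta x))
   - 2 * sinh (w x y) * cos (theta x) * th' x)).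
{ unfold sinh, cosh in *. auto_derive; [repeat split; eexists; eassumption |].
  rewrite (is_derive_unique (fun t : R => w t y) _ _ d1).
  rewrite (is_derive_unique (fun t : R => theta t) _ _ dt). field. }
assert (yy : is_derive (fun t : R => - 2 * cosh (w x t) * cos (theta x) - th' x) y
  (4 * sinh (w x y) * cosh (w x y) * (cos (theta x) * cos (theta x))
   + 2 * sinh (w x y) * cos (theta x) * th' x)).
{ unfold sinh, cosh in *. auto_derive; [repeat split; eexists; eassumption |].
  rewrite (is_derive_unique (fun t : R => w x t) _ _ d2). field. }
rewrite (is_derive_unique _ _ _ xx), (is_derive_unique _ _ _ yy).
replace (2 * w x y) with (w x y + w x y) by ring. rewrite sinh_plus.
assert (sc := sin2_cos2 (theta x)). unfold Rsqr in sc.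
transitivity (4 * sinh (w x y) * cosh (w x y)
  * (sin (theta x) * sin (theta x) + cos (theta x) * cos (theta x)));
  [ring | rewrite sc; ring].
Qed.

(** With [v = u tanh (w / 2)], the Riccati system [v_x = 0],
    [v_y = - (a + b v^2) / 2] makes [v A - G] a solution of the linear system
    with coefficients [0] and [- b v / 2], so it vanishes identically since it
    does at the origin.  Then [A_y = (b v / 2) A], so [A] has no zero. *)
Lemma half_tanh_w (D : C -> Prop) (w : R -> R -> R) (theta A G : R -> R) :
  open D -> path_connected D -> D (0, 0) ->
  sine_Gordon D (fun x _ => theta x) -> class_BT D w (fun x _ => theta x) ->
  coef_a theta * coef_b theta <> 0 ->
  (forall y, is_derive A y (coef_b theta / 2 * G y)) ->
  (forall y, is_derive G y (- (coef_a theta / 2) * A y)) ->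
  A 0 = 1 -> G 0 = tanh (w 0 0 / 2) ->
  forall x y, D (x, y) ->
    A y <> 0 /\ tanh (w x y / 2) = G y / (upath theta x * A y).
Proof.
intros D_open D_conn D0 sG BT ab0 dA dG A0 G0.
assert (th_C2 : C2_on D (fun x _ => theta x)) by apply BT.
assert (eqs := upath_equations D theta D_open D_conn D0 sG th_C2 ab0).
assert (b0 : coef_b theta <> 0) by (intros e; apply ab0; rewrite e; ring).
assert (u_0 : upath theta 0 = 1).
{ unfold upath, coef_b in *. field. exact b0. }
set (a := coef_a theta) in *. set (b := coef_b theta) in *.
set (T := fun x y => tanh (w x y / 2)).
set (v := fun x y => upath theta x * T x y).
assert (dv : forall x y, D (x, y) ->
  is_derive (fun t => v t y) x 0 /\
  is_derive (fun t => v x t) y (- (a + b * v x y ^ 2) / 2)).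
{ intros x y Dxy. destruct (eqs x y Dxy) as [u0 [cos_u [dth du]]].
  destruct (BT_derivatives D w theta x y _ BT Dxy dth) as [wx wy].
  apply is_derive_half_tanh in wx. apply (is_derive_half_tanh (fun t => w x t)) in wy.
  assert (sh := sinh_half_tanh (w x y)). assert (ch := cosh_half_tanh (w x y)).
  unfold v, T. split.
  - evar_last.
    { apply (is_derive_mult (upath theta) (fun t => tanh (w t y / 2)));
        [exact du | exact wx | intros; apply Rmult_comm]. }
    change (2 * sin (theta x) * upath theta x * tanh (w x y / 2)
      + upath theta x * ((1 - tanh (w x y / 2) ^ 2) / 2
                         * (-2 * sinh (w x y) * sin (theta x))) = 0).
    replace ((1 - tanh (w x y / 2) ^ 2) / 2 * (-2 * sinh (w x y) * sin (theta x)))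
      with (- ((1 - tanh (w x y / 2) ^ 2) * sinh (w x y)) * sin (theta x)) by field.
    rewrite sh. ring.
  - evar_last; [apply is_derive_scal, wy |].
    set (t := tanh (w x y / 2)) in *. set (u := upath theta x) in *.
    transitivity (u * (- ((1 - t ^ 2) * cosh (w x y)) * cos (theta x)
                       - (1 - t ^ 2) * (a / u - b * u) / 4)); [simpl; field; exact u0 |].
    rewrite ch, cos_u. field. exact u0. }
assert (zero_x : forall (f : R) x, is_derive (fun _ : R => f) x (0 * f)).
{ intros f x. rewrite Rmult_0_l. apply (is_derive_const (V := R_NormedModule)). }
assert (v_cont : forall c x y, D (x, y) -> continuous (fun t => c * v x t) y).
{ intros c x y Dxy. apply (ex_derive_continuous (fun t => c * v x t)).
  eexists. apply is_derive_scal, (dv x y Dxy). }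
assert (vA : forall x y, D (x, y) -> v x y * A y - G y = 0).
{ intros x y Dxy.
  apply (zero_set_propagates D (fun x y => v x y * A y - G y) (fun _ _ => 0)
           (fun x y => - (b / 2) * v x y) D_open D_conn) with (x := 0) (y := 0);
    try assumption.
  - clear x y Dxy. intros x y Dxy. destruct (dv x y Dxy) as [vx vy].
    split; [|split; [|split]].
    + auto_derive; [eexists; exact vx |].
      rewrite (is_derive_unique (fun t : R => v t y) _ _ vx). ring.
    + assert (dAy := dA y). assert (dGy := dG y).
      auto_derive; [repeat split; eexists; eassumption |].
      rewrite (is_derive_unique (fun t : R => v x t) _ _ vy).
      rewrite (is_derive_unique (fun t : R => A t) _ _ dAy).
      rewrite (is_derive_unique (fun t : R => G t) _ _ dGy). field.
    + apply continuous_const.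
    + now apply v_cont.
  - unfold v, T. rewrite u_0, A0, G0. ring. }
assert (A_neq0 : forall x y, D (x, y) -> A y <> 0).
{ intros x y Dxy Ay0. apply R1_neq_R0. rewrite <- A0.
  apply (zero_set_propagates D (fun _ y => A y) (fun _ _ => 0)
           (fun x y => b / 2 * v x y) D_open D_conn) with (x := x) (y := y) (x' := 0);
    try assumption.
  clear x y Dxy Ay0. intros x y Dxy. split; [apply zero_x | split; [|split]].
  - evar_last; [apply dA |]. assert (e := vA x y Dxy).
    replace (G y) with (v x y * A y) by lra. ring.
  - apply continuous_const.
  - now apply v_cont. }
intros x y Dxy. split; [now apply A_neq0 with x |].
destruct (eqs x y Dxy) as [u0 _]. assert (e := vA x y Dxy).
replace (G y) with (v x y * A y) by lra. unfold v, T.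
field. split; [now apply A_neq0 with x | exact u0].
Qed.

(** * Wirtinger derivatives *)

Lemma Cdx_ext (U : C -> Prop) (f g : R -> R -> C) :
  open U -> (forall x y, U (x, y) -> f x y = g x y) ->
  forall x y, U (x, y) -> Cdx f x y = Cdx g x y.
Proof.
intros U_open fg x y Uxy. destruct (open_box U x y U_open Uxy) as [d Hd].
assert (y0 : Rabs (y - y) < d) by (rewrite Rminus_diag, Rabs_R0; apply cond_pos).
unfold Cdx, dx. f_equal; apply Derive_ext_loc; exists d; intros t Ht;
  now rewrite fg by now apply Hd.
Qed.

Lemma Cdy_ext (U : C -> Prop) (f g : R -> R -> C) :
  open U -> (forall x y, U (x, y) -> f x y = g x y) ->
  forall x y, U (x, y) -> Cdy f x y = Cdy g x y.
Proof.
intros U_open fg x y Uxy. destruct (open_box U x y U_open Uxy) as [d Hd].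
assert (x0 : Rabs (x - x) < d) by (rewrite Rminus_diag, Rabs_R0; apply cond_pos).
unfold Cdy, dy. f_equal; apply Derive_ext_loc; exists d; intros t Ht;
  now rewrite fg by now apply Hd.
Qed.

Lemma dz_ext (U : C -> Prop) (f g : R -> R -> C) :
  open U -> (forall x y, U (x, y) -> f x y = g x y) ->
  forall x y, U (x, y) -> dz f x y = dz g x y.
Proof.
intros U_open fg x y Uxy. unfold dz.
now rewrite (Cdx_ext U f g U_open fg x y Uxy), (Cdy_ext U f g U_open fg x y Uxy).
Qed.

Lemma dzbar_ext (U : C -> Prop) (f g : R -> R -> C) :
  open U -> (forall x y, U (x, y) -> f x y = g x y) ->
  forall x y, U (x, y) -> dzbar f x y = dzbar g x y.
Proof.
intros U_open fg x y Uxy. unfold dzbar.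
now rewrite (Cdx_ext U f g U_open fg x y Uxy), (Cdy_ext U f g U_open fg x y Uxy).
Qed.

Lemma dz_dzbar_components (f : R -> R -> C) (x y p1 q1 p2 q2 : R) :
  is_derive (fun t => Re (f t y)) x p1 -> is_derive (fun t => Im (f t y)) x q1 ->
  is_derive (fun t => Re (f x t)) y p2 -> is_derive (fun t => Im (f x t)) y q2 ->
  dz f x y = ((p1 + q2) / 2, (q1 - p2) / 2) /\
  dzbar f x y = ((p1 - q2) / 2, (q1 + p2) / 2).
Proof.
intros d1 d2 d3 d4. unfold dz, dzbar, Cdx, Cdy, dx, dy.
rewrite (is_derive_unique (fun t : R => Re (f t y)) _ _ d1).
rewrite (is_derive_unique (fun t : R => Im (f t y)) _ _ d2).
rewrite (is_derive_unique (fun t : R => Re (f x t)) _ _ d3).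
rewrite (is_derive_unique (fun t : R => Im (f x t)) _ _ d4).
split; apply injective_projections; simpl; field.
Qed.

Lemma corresponding_harmonic_map_ext (U : C -> Prop) (w : R -> R -> R)
    (f g : R -> R -> C) :
  open U -> (forall x y, U (x, y) -> f x y = g x y) ->
  corresponding_harmonic_map U w f -> corresponding_harmonic_map U w g.
Proof.
intros U_open fg [w_C2 [w_sG [f_Re [f_Im H]]]].
split; [exact w_C2 | split; [exact w_sG | split; [|split]]].
- apply (Cn_on_ext U 2 (fun x y => Re (f x y))); [exact U_open | | exact f_Re].
  intros x y Uxy. now rewrite fg.
- apply (Cn_on_ext U 2 (fun x y => Im (f x y))); [exact U_open | | exact f_Im].
  intros x y Uxy. now rewrite fg.
- intros x y Uxy.
  rewrite <- (dz_ext U f g U_open fg x y Uxy), <- (dzbar_ext U f g U_open fg x y Uxy).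
  rewrite <- (dz_ext U (dzbar f) (dzbar g) U_open (dzbar_ext U f g U_open fg) x y Uxy).
  rewrite <- (dz_ext U (fun s t => Cconj (f s t)) (fun s t => Cconj (g s t)) U_open)
    by (try (intros s t Ust; now rewrite fg); exact Uxy).
  rewrite <- (fg x y Uxy). exact (H x y Uxy).
Qed.

(** * The harmonic map *)

(** The span of products of these four functions is stable under
    differentiation, so the regularity of all four grows together. *)
Lemma Cn_on_profile (U : C -> Prop) (theta u : R -> R) (a b : R) (n : nat) :
  open U ->
  (forall x y, U (x, y) ->
     u x <> 0 /\
     is_derive theta x ((a / u x - b * u x) / 2) /\
     is_derive u x (2 * sin (theta x) * u x)) ->
  Cn_on U n (fun x _ => sin (theta x)) /\ Cn_on U n (fun x _ => cos (theta x)) /\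
  Cn_on U n (fun x _ => u x) /\ Cn_on U n (fun x _ => / u x).
Proof.
intros U_open sys.
set (th' := fun x => (a / 2) * / u x + (- b / 2) * u x).
assert (d_sin : forall x y, U (x, y) ->
  is_derive (fun x => sin (theta x)) x (th' x * cos (theta x))).
{ intros x y Uxy. destruct (sys x y Uxy) as [u0 [dth _]].
  apply (is_derive_comp sin theta); [apply is_derive_sin |].
  evar_last; [exact dth | unfold th'; field; exact u0]. }
assert (d_cos : forall x y, U (x, y) ->
  is_derive (fun x => cos (theta x)) x (th' x * (-1 * sin (theta x)))).
{ intros x y Uxy. destruct (sys x y Uxy) as [u0 [dth _]].
  evar_last.
  - apply (is_derive_comp cos theta); [apply is_derive_cos | exact dth].
  - unfold th', scal; simpl; unfold mult; simpl. field. exact u0. }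
assert (d_u : forall x y, U (x, y) -> is_derive u x (2 * (sin (theta x) * u x))).
{ intros x y Uxy. destruct (sys x y Uxy) as [_ [_ du]].
  evar_last; [exact du | ring]. }
assert (d_v : forall x y, U (x, y) ->
  is_derive (fun x => / u x) x (-2 * (sin (theta x) * / u x))).
{ intros x y Uxy. destruct (sys x y Uxy) as [u0 [_ du]].
  evar_last; [apply (is_derive_inv u), u0; exact du | field; exact u0]. }
induction n as [|n [IHs [IHc [IHu IHv]]]].
- split; [|split; [|split]];
    [ exact (continuous_on_fst U _ _ d_sin) | exact (continuous_on_fst U _ _ d_cos)
    | exact (continuous_on_fst U _ _ d_u) | exact (continuous_on_fst U _ _ d_v)].
- assert (IHth : Cn_on U n (fun x _ => th' x)).
  { apply Cn_on_plus; [assumption | |]; apply Cn_on_mult; try assumption;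
      now apply Cn_on_const. }
  split; [|split; [|split]];
    [ apply (Cn_on_fst U n _ _ U_open d_sin) | apply (Cn_on_fst U n _ _ U_open d_cos)
    | apply (Cn_on_fst U n _ _ U_open d_u) | apply (Cn_on_fst U n _ _ U_open d_v)];
    repeat (apply Cn_on_mult; [assumption | |]);
    try assumption; now apply Cn_on_const.
Qed.

Lemma Cn_on_amplitudes (U : C -> Prop) (A G : R -> R) (a b : R) (n : nat) :
  open U ->
  (forall y, is_derive A y (b / 2 * G y)) ->
  (forall y, is_derive G y (- (a / 2) * A y)) ->
  Cn_on U n (fun _ y => A y) /\ Cn_on U n (fun _ y => G y).
Proof.
intros U_open dA dG. induction n as [|n [IHA IHG]].
- split; [ exact (continuous_on_snd U _ _ (fun _ y _ => dA y))
         | exact (continuous_on_snd U _ _ (fun _ y _ => dG y))].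
- split; [ apply (Cn_on_snd U n _ _ U_open (fun _ y _ => dA y))
         | apply (Cn_on_snd U n _ _ U_open (fun _ y _ => dG y))];
    (apply Cn_on_mult; [assumption | now apply Cn_on_const | assumption]).
Qed.

Ltac rewrite_derivatives :=
  repeat match goal with
  | H : is_derive ?f ?x ?l |- _ =>
      progress rewrite (is_derive_unique (fun t : R => f t) x l H)
  end.

Ltac differentiate :=
  auto_derive; [repeat split; try assumption; eexists; eassumption |];
  rewrite_derivatives.

(** Everything is an identity between [u], [A], [G], [cos theta], [sin theta]:
    the x-derivative of the map is [2 K e^{i theta} P] with [P] as below, so that
    [d_z] and [d_zbar] of the map are [K e^{i theta} (P + 2 A G)] and
    [K e^{i theta} (P - 2 A G)], and these are squares up to the factor [u A^2]
    because [G = u A tanh (w / 2)]. *)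
Lemma harmonic_map_of_profile (U : C -> Prop) (w : R -> R -> R)
    (theta u J A G : R -> R) (a b T0 K R0 : R) :
  open U -> K <> 0 -> b <> 0 ->
  C2_on U w -> sinh_Gordon U w ->
  (forall y, is_derive A y (b / 2 * G y)) ->
  (forall y, is_derive G y (- (a / 2) * A y)) ->
  (forall y, a * A y ^ 2 + b * G y ^ 2 = a + b * T0 ^ 2) ->
  (forall x y, U (x, y) ->
     u x <> 0 /\ cos (theta x) = (b * u x + a / u x) / 4 /\
     is_derive theta x ((a / u x - b * u x) / 2) /\
     is_derive u x (2 * sin (theta x) * u x)) ->
  (forall x y, U (x, y) ->
     is_derive J x (2 * (u x + T0 ^ 2 / u x) * cos (theta x))) ->
  (forall x y, U (x, y) ->
     A y <> 0 /\ tanh (w x y / 2) = G y / (u x * A y)) ->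
  corresponding_harmonic_map U w
    (fun x y => (R0 + K * J x - 4 * K / b * sin (theta x) * (A y ^ 2 - 1),
                 K * (u x * A y ^ 2 - G y ^ 2 / u x))).
Proof.
intros U_open K0 b0 w_C2 w_sG dA dG inv eqs dJ tanh_w.
split; [exact w_C2 | split; [exact w_sG |]].
assert (reg_x : forall n, Cn_on U n (fun x _ => sin (theta x)) /\
  Cn_on U n (fun x _ => cos (theta x)) /\
  Cn_on U n (fun x _ => u x) /\ Cn_on U n (fun x _ => / u x)).
{ intros n. apply (Cn_on_profile U theta u a b n U_open).
  intros x y Uxy. destruct (eqs x y Uxy) as [u0 [_ [dth du]]]. now split. }
destruct (Cn_on_amplitudes U A G a b 2 U_open dA dG) as [A_C2 G_C2].
destruct (reg_x 2%nat) as [s_C2 [_ [u_C2 v_C2]]].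
assert (J_C2 : Cn_on U 2 (fun x _ => J x)).
{ apply (Cn_on_fst U 1 J (fun x => 2 * (u x + T0 ^ 2 * / u x) * cos (theta x)));
    [assumption | exact dJ |].
  destruct (reg_x 1%nat) as [_ [c_C1 [u_C1 v_C1]]].
  repeat (apply Cn_on_mult || apply Cn_on_plus); try assumption; now apply Cn_on_const. }
split; [|split].
- apply Cn_on_ext with (fun x y =>
    (R0 + K * J x) + (- (4 * K / b)) * (sin (theta x) * (A y * A y + -1))).
  + assumption.
  + intros x y _. simpl. ring.
  + repeat (apply Cn_on_mult || apply Cn_on_plus); try assumption; now apply Cn_on_const.
- apply Cn_on_ext with (fun x y =>
    K * (u x * (A y * A y) + -1 * (G y * G y * / u x))).
  + assumption.
  + intros x y _. simpl. unfold Rdiv. ring.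
  + repeat (apply Cn_on_mult || apply Cn_on_plus); try assumption; now apply Cn_on_const.
- set (f := fun x y : R => (_, _) : C).
  set (P := fun x y => u x * A y ^ 2 + G y ^ 2 / u x).
  assert (df : forall x y, U (x, y) ->
    is_derive (fun t => Re (f t y)) x (2 * K * cos (theta x) * P x y) /\
    is_derive (fun t => Im (f t y)) x (2 * K * sin (theta x) * P x y) /\
    is_derive (fun t => Re (f x t)) y (- (4 * K * sin (theta x) * A y * G y)) /\
    is_derive (fun t => Im (f x t)) y (4 * K * cos (theta x) * A y * G y)).
  { intros x y Uxy. destruct (eqs x y Uxy) as [u0 [cos_u [dth du]]].
    assert (dJx := dJ x y Uxy). assert (dAy := dA y). assert (dGy := dG y).
    assert (G2 : G y ^ 2 = (a + b * T0 ^ 2 - a * A y ^ 2) / b)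
      by (rewrite <- (inv y); field; exact b0).
    unfold f, P. simpl Re. simpl Im. split; [|split; [|split]].
    - differentiate. rewrite G2. field. now split.
    - differentiate. field. exact u0.
    - differentiate. field. exact b0.
    - differentiate. rewrite cos_u. field. exact u0. }
  set (M := fun x y => P x y - 2 * A y * G y).
  assert (dz_f : forall x y, U (x, y) ->
    dz f x y = (K * cos (theta x) * (P x y + 2 * A y * G y),
                K * sin (theta x) * (P x y + 2 * A y * G y)) /\
    dzbar f x y = (K * cos (theta x) * M x y, K * sin (theta x) * M x y)).
  { intros x y Uxy. destruct (df x y Uxy) as [d1 [d2 [d3 d4]]].
    destruct (dz_dzbar_components f x y _ _ _ _ d1 d2 d3 d4) as [-> ->].
    unfold M. split; apply injective_projections; simpl; field. }
  intros x y Uxy S.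
  destruct (eqs x y Uxy) as [u0 [cos_u [dth du]]].
  destruct (tanh_w x y Uxy) as [A0 T_eq].
  destruct (exp_half_tanh (w x y)) as [T1 expT].
  assert (sq := sin2_cos2 (theta x)). unfold Rsqr in sq.
  assert (dAy := dA y). assert (dGy := dG y).
  set (T := tanh (w x y / 2)) in *.
  assert (T2 : 1 - T ^ 2 <> 0).
  { intros e. unfold T in e. assert (ch := cosh_tanh (w x y / 2)).
    rewrite e in ch. lra. }
  assert (G_eq : G y = u x * A y * T) by (rewrite T_eq; field; now split).
  assert (S_eq : S = K * (u x * A y ^ 2 * (1 - T ^ 2))).
  { unfold S, f. simpl. rewrite G_eq. field. exact u0. }
  assert (P_eq : P x y + 2 * A y * G y = u x * A y ^ 2 * (1 + T) ^ 2).
  { unfold P. rewrite G_eq. field. exact u0. }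
  assert (M_eq : M x y = u x * A y ^ 2 * (1 - T) ^ 2).
  { unfold M, P. rewrite G_eq. field. exact u0. }
  assert (uA0 : u x * A y ^ 2 <> 0).
  { apply Rmult_integral_contrapositive_currified; [exact u0 | now apply pow_nonzero]. }
  assert (S0 : S <> 0).
  { rewrite S_eq. apply Rmult_integral_contrapositive_currified; [exact K0 |].
    now apply Rmult_integral_contrapositive_currified. }
  assert (CS0 : RtoC S <> RtoC 0) by (intros e; apply S0, RtoC_inj, e).
  assert (dz0 : dz f x y <> RtoC 0).
  { rewrite (proj1 (dz_f x y Uxy)), P_eq. intros e.
    assert (e1 := f_equal fst e). assert (e2 := f_equal snd e). simpl in e1, e2.
    assert (X0 : K * (u x * A y ^ 2 * (1 + T) ^ 2) <> 0).
    { apply Rmult_integral_contrapositive_currified; [exact K0 |].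
      apply Rmult_integral_contrapositive_currified;
        [exact uA0 | now apply pow_nonzero]. }
    assert (c0 : cos (theta x) = 0) by (apply Rmult_eq_reg_l with (2 := X0); simpl; lra).
    assert (s0 : sin (theta x) = 0) by (apply Rmult_eq_reg_l with (2 := X0); simpl; lra).
    rewrite c0, s0 in sq. lra. }
  split; [exact S0 | split; [exact dz0 | split; [|split]]].
  + replace (dzbar f x y) with (RtoC (exp (-2 * w x y)) * dz f x y)%C.
    * field. exact dz0.
    * destruct (dz_f x y Uxy) as [-> ->]. rewrite P_eq, M_eq, <- expT.
      apply injective_projections; simpl; ring.
  + rewrite (dz_ext U (dzbar f)
      (fun x y => (K * cos (theta x) * M x y, K * sin (theta x) * M x y))
      U_open (fun x y Uxy => proj2 (dz_f x y Uxy)) x y Uxy).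
    destruct (dz_dzbar_components
      (fun x y => (K * cos (theta x) * M x y, K * sin (theta x) * M x y)) x y
      (K * (- sin (theta x) * ((a / u x - b * u x) / 2) * M x y
            + cos (theta x) * (2 * sin (theta x) * (u x * A y ^ 2 - G y ^ 2 / u x))))
      (K * (cos (theta x) * ((a / u x - b * u x) / 2) * M x y
            + sin (theta x) * (2 * sin (theta x) * (u x * A y ^ 2 - G y ^ 2 / u x))))
      (K * cos (theta x) * (A y * G y * (b * u x - a / u x) - b * G y ^ 2 + a * A y ^ 2))
      (K * sin (theta x) * (A y * G y * (b * u x - a / u x) - b * G y ^ 2 + a * A y ^ 2)))
      as [-> _].
    1,2,3,4: unfold M, P; simpl Re; simpl Im; differentiate; field; exact u0.
    replace (Ci / RtoC S * dz f x y * dzbar f x y)%C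
      with (Ci * RtoC S * (cos (theta x), sin (theta x))
            * (cos (theta x), sin (theta x)))%C.
    * rewrite S_eq. unfold M, P. rewrite G_eq.
      apply injective_projections; simpl; rewrite cos_u; field; exact u0.
    * apply (Cmult_eq_reg_l (RtoC S)); [exact CS0 |].
      transitivity (Ci * (dz f x y * dzbar f x y))%C; [|field; exact CS0].
      destruct (dz_f x y Uxy) as [-> ->]. rewrite P_eq, M_eq, S_eq.
      apply injective_projections; simpl; ring.
  + change ((dz f x y * dz (fun s t => Cconj (f s t)) x y
             / (RtoC S * RtoC S))%C = RtoC 1).
    destruct (df x y Uxy) as [d1 [d2 [d3 d4]]].
    destruct (dz_dzbar_components (fun s t => Cconj (f s t)) x y _ _ _ _ d1
      (is_derive_opp _ _ _ d2) d3 (is_derive_opp _ _ _ d4)) as [-> _].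
    unfold opp; simpl.
    rewrite (proj1 (dz_f x y Uxy)), P_eq.
    apply (Cmult_eq_reg_l (RtoC S * RtoC S)); [now apply Cmult_neq_0 |].
    transitivity (((K * cos (theta x) * (u x * A y ^ 2 * (1 + T) ^ 2))%R,
                   (K * sin (theta x) * (u x * A y ^ 2 * (1 + T) ^ 2))%R)
      * ((K * cos (theta x) * M x y)%R, (- (K * sin (theta x) * M x y))%R))%C.
    * unfold M.
      replace ((2 * K * cos (theta x) * P x y + - (4 * K * cos (theta x) * A y * G y)) / 2)
        with (K * cos (theta x) * (P x y - 2 * A y * G y)) by field.
      replace ((- (2 * K * sin (theta x) * P x y)
                - - (4 * K * sin (theta x) * A y * G y)) / 2)
        with (- (K * sin (theta x) * (P x y - 2 * A y * G y))) by field.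
      field. exact CS0.
    * rewrite M_eq, S_eq. apply injective_projections; simpl; [|ring].
      transitivity (K * K * (u x * A y ^ 2) ^ 2 * (1 - T ^ 2) ^ 2
        * (sin (theta x) * sin (theta x) + cos (theta x) * cos (theta x)));
        [ring | rewrite sq; ring].
Qed.

Theorem theorem6
  (D : C -> Prop) (w : R -> R -> R) (theta : R -> R)
  (D_open : open D) (D_sc : simply_connected D) (D_0 : D (0, 0))
  (theta_sG : sine_Gordon D (fun x _ => theta x))
  (theta_nonconst : exists p q : C, D p /\ D q /\ theta (fst p) <> theta (fst q))
  (w_theta_BT : class_BT D w (fun x _ => theta x))
  (ab_neq0 : coef_a theta * coef_b theta <> 0)
  (r : C) (r_sqrt : Cmult r r = RtoC (coef_a theta * coef_b theta))
  (k : C) (k_tan : Ccos k <> RtoC 0)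
  (k_eq : RtoC (tanh (w 0 0 / 2)) = Copp (Cmult (Cdiv r (RtoC (coef_b theta))) (Ctan k)))
  (R0 S0 : R) (S0_neq0 : S0 <> 0)
  (Omega : C -> Prop)
  (Omega_open : open Omega) (Omega_sc : simply_connected Omega)
  (Omega_0 : Omega (0, 0))
  (Omega_D : forall p : C, Omega p -> D p)
  (Omega_def : formulas_defined Omega theta (w 0 0) k) :
  (forall x y : R, Omega (x, y) ->
     Im (R_formula theta (w 0 0) r k R0 S0 x y) = 0 /\
     Im (S_formula theta r k S0 x y) = 0) /\
  corresponding_harmonic_map Omega w
    (fun x y : R => (Re (R_formula theta (w 0 0) r k R0 S0 x y),
                     Re (S_formula theta r k S0 x y))).
Proof.
assert (D_conn : path_connected D) by apply D_sc.
assert (th_C2 : C2_on D (fun x _ => theta x)) by apply w_theta_BT.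
assert (eqs := upath_equations D theta D_open D_conn D_0 theta_sG th_C2 ab_neq0).
destruct (amplitude_pair _ _ _ r k ab_neq0 r_sqrt k_tan k_eq)
  as [A [G [dA [dG [A0 [G0 [den0 [inv Ccos_eq]]]]]]]].
assert (tanh_w := half_tanh_w D w theta A G D_open D_conn D_0 theta_sG w_theta_BT
                    ab_neq0 dA dG A0 G0).
destruct Omega_def as [_ J_int].
set (T0 := tanh (w 0 0 / 2)) in *.
set (K := S0 * cosh (w 0 0 / 2) ^ 2).
assert (formulas : forall x y, Omega (x, y) ->
  R_formula theta (w 0 0) r k R0 S0 x y
  = RtoC (R0 + K * J_along theta T0 x
          - 4 * K / coef_b theta * sin (theta x) * (A y ^ 2 - 1)) /\
  S_formula theta r k S0 x y
  = RtoC (K * (upath theta x * A y ^ 2 - G y ^ 2 / upath theta x))).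
{ intros x y Oxy. destruct (eqs x y (Omega_D _ Oxy)) as [u0 [cos_u [dth _]]].
  apply (fun f : R -> R => is_derive_unique f x _) in dth.
  assert (lo0 : 2 * cos (theta 0) - Derive theta 0 = coef_b theta) by reflexivity.
  assert (hi0 : 2 * cos (theta 0) + Derive theta 0 = coef_a theta) by reflexivity.
  set (a := coef_a theta) in *. set (b := coef_b theta) in *.
  assert (a0 : a <> 0) by (intros e; apply ab_neq0; rewrite e; ring).
  assert (b0 : b <> 0) by (intros e; apply ab_neq0; rewrite e; ring).
  assert (ch := cosh_tanh (w 0 0 / 2)). fold T0 in ch.
  assert (T2 : 1 - T0 ^ 2 <> 0) by (intros e; rewrite e in ch; lra).
  assert (cosh_eq : cosh (w 0 0 / 2) ^ 2 = / (1 - T0 ^ 2)).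
  { apply (Rmult_eq_reg_r (1 - T0 ^ 2)); [rewrite ch; field |]; exact T2. }
  assert (den : denominator theta k = RtoC (a * b * (1 - T0 ^ 2) / (a + b * T0 ^ 2))).
  { unfold denominator. replace (2 * k)%C with (r * RtoC 0 + 2 * k)%C by ring.
    rewrite (Ccos_eq 0), A0, G0, <- RtoC_mult, <- RtoC_minus. f_equal.
    replace (2 * cos (theta 0)) with ((a + b) / 2) by lra.
    replace (Derive theta 0) with ((a - b) / 2) by lra.
    field. exact den0. }
  assert (den_neq0 : a * b * (1 - T0 ^ 2) / (a + b * T0 ^ 2) <> 0).
  { apply Rmult_integral_contrapositive_currified;
      [now apply Rmult_integral_contrapositive_currified | now apply Rinv_neq_0_compat]. }
  assert (G2 : G y ^ 2 = (a + b * T0 ^ 2 - a * A y ^ 2) / b)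
    by (rewrite <- (inv y); field; exact b0).
  unfold R_formula, S_formula. fold T0 K. rewrite den, Ccos_eq.
  replace (Ccos (2 * k)) with (Ccos (r * RtoC 0 + 2 * k)) by (f_equal; ring).
  rewrite (Ccos_eq 0), A0, G0, G2.
  split.
  - rewrite <- RtoC_minus, <- RtoC_mult, <- RtoC_div, <- RtoC_mult, <- RtoC_minus
      by exact den_neq0.
    f_equal. unfold K. rewrite cosh_eq. field. now repeat split.
  - rewrite <- RtoC_mult, <- RtoC_minus, <- RtoC_div, <- RtoC_mult by exact den_neq0.
    f_equal. unfold K. rewrite cosh_eq, cos_u, dth. field. now repeat split. }
split.
{ intros x y Oxy. destruct (formulas x y Oxy) as [-> ->]. now split. }
apply corresponding_harmonic_map_ext with (2 := fun x y Oxy =>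
  f_equal2 pair (eq_sym (f_equal Re (proj1 (formulas x y Oxy))))
                (eq_sym (f_equal Re (proj2 (formulas x y Oxy))))); [exact Omega_open |].
assert (dth : forall x y, D (x, y) -> is_derive theta x
  ((coef_a theta / upath theta x - coef_b theta * upath theta x) / 2)).
{ intros x y Dxy. now destruct (eqs x y Dxy) as [_ [_ [? _]]]. }
apply (harmonic_map_of_profile Omega w theta (upath theta) (J_along theta T0) A G
         (coef_a theta) (coef_b theta) T0 K R0).
- exact Omega_open.
- apply Rmult_integral_contrapositive_currified; [exact S0_neq0 |].
  apply pow_nonzero, Rgt_not_eq. unfold cosh.
  assert (p := exp_pos (w 0 0 / 2)). assert (q := exp_pos (- (w 0 0 / 2))). lra.
- intros e. apply ab_neq0. rewrite e. ring.
- intros x y Oxy. now apply w_theta_BT, Omega_D.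
- intros x y Oxy. apply (BT_sinh_Gordon D w theta _ D_open dth w_theta_BT).
  now apply Omega_D.
- exact dA.
- exact dG.
- exact inv.
- intros x y Oxy. now apply eqs with y, Omega_D.
- intros x y Oxy. apply (is_derive_J_along D theta T0 D_open D_conn D_0 theta_sG
    th_C2 ab_neq0 theta_nonconst x y (Omega_D _ Oxy)). now apply J_int with y.
- intros x y Oxy. now apply tanh_w, Omega_D.
Qed.
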